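(* Let $\Gamma=\mathrm{Cay}(\mathbb{Z}_n,S)$ be a connected $|S|$-regular graph such that all elements of $S$ are odd, i.e. $S=\{x^t : t\in T\}$ for some set $T$ of odd integers. Then $\Gamma$ contains a $(0,|S|)$-regular set if and only if $n$ is even.
   Context: $\mathbb{Z}_n=\langle x\rangle$ denotes the cyclic group of order $n$, written multiplicatively, with identity $e$, and $S\subseteq\mathbb{Z}_n\setminus\{e\}$ is inverse-closed. The Cayley graph $\mathrm{Cay}(\mathbb{Z}_n,S)$ is the simple graph with vertex set $\mathbb{Z}_n$ in which $y$ and $z$ are adjacent if and only if $y^{-1}z\in S$. For a graph $\Gamma$ and nonnegative integers $a,b$, a nonempty proper subset $C$ of $V(\Gamma)$ is an $(a,b)$-regular set of $\Gamma$ if every vertex in $C$ has exactly $a$ neighbours in $C$ and every vertex in $V(\Gamma)\setminus C$ has exactly $b$ neighbours in $C$. *)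

(* Defs.v *)
From mathcomp Require Import all_boot all_order all_fingroup all_algebra.

Set Implicit Arguments.
Unset Strict Implicit.
Unset Printing Implicit Defensive.

Import GroupScope.

(* Graphs are adjacency relations on a finite vertex type; the Cayley graph is
   simple when S is inverse-closed and avoids 1, see [cayley_sym] and
   [cayley_irr]. *)

Definition graph_connected (V : finType) (e : rel V) : Prop :=
  forall u v : V, connect e u v.

Definition graph_regular (V : finType) (e : rel V) (k : nat) : Prop :=
  forall v : V, #|[set w | e v w]| = k.

Definition regular_set (V : finType) (e : rel V) (a b : nat) (C : {set V})
    : Prop :=
  [/\ C != set0, C != [set: V],
      forall v, v \in C -> #|[set w in C | e v w]| = a
    & forall v, v \notin C -> #|[set w in C | e v w]| = b].

Definition inverse_closed (gT : finGroupType) (S : {set gT}) : Prop :=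
  forall s, s \in S -> s^-1 \in S.

Definition cayley (gT : finGroupType) (S : {set gT}) : rel gT :=
  fun y z => y^-1 * z \in S.

Lemma cayley_sym (gT : finGroupType) (S : {set gT}) :
  inverse_closed S -> symmetric (cayley S).
Proof.
move=> SV y z; apply/idP/idP; rewrite /cayley => /SV; by rewrite invMg invgK.
Qed.

Lemma cayley_irr (gT : finGroupType) (S : {set gT}) :
  1 \notin S -> irreflexive (cayley S).
Proof. by move=> S1 y; rewrite /cayley mulVg; apply/negbTE. Qed.

(* MathComp has no integer powers in groups; [Negz m] is the integer -(m+1). *)
Definition expgz (gT : finGroupType) (x : gT) (t : int) : gT :=
  match t with
  | Posz m => x ^+ m
  | Negz m => x ^- m.+1
  end.

(* T is an arbitrary, possibly infinite, set of integers. When x has odd order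
   the parity of an exponent of a given group element is not determined. *)
Definition all_odd (gT : finGroupType) (x : gT) (S : {set gT}) : Prop :=
  exists T : int -> Prop,
    (forall t, T t -> odd (absz t)) /\
    (forall y, y \in S <-> exists2 t, T t & y = expgz x t).

(* Main.v *)
Require Import Defs.
From mathcomp Require Import all_boot all_order all_fingroup all_algebra.
From mathcomp Require Import cyclic.

Set Implicit Arguments.
Unset Strict Implicit.
Unset Printing Implicit Defensive.

Import GroupScope.

(** In a k-regular graph a (0, k)-regular set is the same thing as one side of
    a bipartition: no edge stays inside C, and a vertex outside C spends all of
    its k edges on C ([regular_set_bipartition]). So the question is whether
    the Cayley graph is bipartite with both sides nonempty.

    If C is such a side, right multiplication by any s in S exchanges C with
    its complement, so membership of v * s ^+ k in C alternates with k. Since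
    s ^+ #[s] = 1, the order of s is even, and it divides the order of the
    group. Connectedness supplies some s in S, because both sides are
    nonempty.

    Conversely, if x has even order then the parity of an exponent of x is well
    defined ([mem_cycle_sqr]), and multiplication by an odd power of x changes
    it. The even powers, that is the subgroup <[x ^+ 2]>, form one side. *)

Lemma regular_set_bipartition (V : finType) (e : rel V) (k : nat)
    (C : {set V}) :
    graph_regular e k ->
  regular_set e 0 k C <->
    [/\ C != set0, C != [set: V]
      & forall v w, e v w -> (w \in C) = (v \notin C)].
Proof.
move=> reg; split=> [[C0 CT inC outC] | [C0 CT alt]]; split=> //.
- move=> v w evw; case: (boolP (v \in C)) => [vC | vC] /=.
    apply/negbTE/negP=> wC.
    by have /eqP := inC v vC; rewrite cards_eq0 => /eqP/setP/(_ w);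
       rewrite !inE wC evw.
  (* The neighbours of v in C are as many as all the neighbours of v. *)
  have sub : [set u in C | e v u] \subset [set u | e v u].
    by apply/subsetP=> u; rewrite !inE => /andP[].
  have /eqP/setP/(_ w) : [set u in C | e v u] == [set u | e v u].
    by rewrite eqEcard sub outC //= reg.
  by rewrite !inE evw andbT.
- move=> v vC; apply/eqP; rewrite cards_eq0; apply/eqP/setP=> w; rewrite !inE.
  by apply/negbTE/negP=> /andP[wC /alt]; rewrite wC vC.
- move=> v vC; rewrite -[RHS](reg v); apply: eq_card => w; rewrite !inE.
  by case evw: (e v w); rewrite ?andbF // (alt _ _ evw) vC.
Qed.

Lemma connected_nonempty (gT : finGroupType) (S : {set gT}) (u v : gT) :
  graph_connected (cayley S) -> u != v -> exists s, s \in S.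
Proof.
move=> conn neq_uv; have /connectP[[|w p] /=] := conn u v.
  by move=> _ eq_vu; rewrite eq_vu eqxx in neq_uv.
by case/andP=> S_uw _ _; exists (u^-1 * w).
Qed.

(** The walk v, v * s, v * s ^+ 2, ... returns to v after #[s] steps and changes
    sides at each step, so it cannot have odd length. *)
Lemma swapped_order_even (gT : finGroupType) (C : {set gT}) (s : gT) :
  (forall v, (v * s \in C) = (v \notin C)) -> ~~ odd #[s].
Proof.
move=> swap.
have swapX k v : (v * s ^+ k \in C) = (v \in C) (+) odd k.
  elim: k => [|k IHk]; first by rewrite mulg1 addbF.
  by rewrite expgSr mulgA swap IHk /= addbN.
have := swapX #[s] 1; rewrite expg_order mulg1.
by case: (odd _) (1 \in C) => [] [].
Qed.

Lemma mem_cycle_sqr (gT : finGroupType) (x : gT) (i : nat) :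
  ~~ odd #[x] -> (x ^+ i \in <[x ^+ 2]>) = ~~ odd i.
Proof.
move=> /negbTE even_x; apply/idP/idP=> [/cycleP[k] | even_i].
  rewrite -expgM mul2n => /eqP; rewrite eq_expg_mod_order => /eqP eq_mod.
  by rewrite -(odd_mod i even_x) eq_mod odd_mod // odd_double.
by rewrite -(even_halfK even_i) -mul2n expgM mem_cycle.
Qed.

(** A negative exponent t may be replaced by its opposite multiplied by
    #[x] - 1, which is odd as well because #[x] is even. *)
Lemma expgz_odd (gT : finGroupType) (x : gT) (t : int) :
  ~~ odd #[x] -> odd (absz t) -> exists2 j, odd j & expgz x t = x ^+ j.
Proof.
move=> even_x; case: t => m odd_m; first by exists m.
exists (#[x].-1 * m.+1)%N; last by rewrite /= expgM -invg_expg expgVn.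
rewrite oddM [odd m.+1]odd_m andbT.
by move: even_x (order_gt0 x); case: #[x] => // k /=; rewrite negbK.
Qed.

Theorem theorem4p8 (n : nat) (gT : finGroupType) (x : gT)
    (gen_x : <[x]> = [set: gT]) (ord_x : #[x] = n)
    (S : {set gT}) (S1 : 1 \notin S) (SV : inverse_closed S)
    (conn : graph_connected (cayley S))
    (reg : graph_regular (cayley S) #|S|)
    (S_odd : all_odd x S) :
  (exists C : {set gT}, regular_set (cayley S) 0 #|S| C) <-> ~~ odd n.
Proof.
split=> [[C /(regular_set_bipartition _ reg)[C0 CT alt]] | even_n].
  have [u uC] := set0Pn _ C0.
  have /subsetPn[v _ vC] : ~~ ([set: gT] \subset C) by rewrite subTset.
  have neq_uv : u != v by apply: contraNneq vC => <-.
  have [s sS] := connected_nonempty conn neq_uv.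
  have even_s : ~~ odd #[s].
    by apply: (@swapped_order_even _ C) => w; apply: alt; rewrite /cayley mulKg.
  apply: contra even_s; apply: dvdn_odd.
  by rewrite -ord_x [#[x]]/order gen_x order_dvdG // inE.
rewrite -ord_x in even_n; have [T [T_odd S_T]] := S_odd.
exists <[x ^+ 2]>; apply/(regular_set_bipartition _ reg); split.
- by apply/set0Pn; exists 1; apply: group1.
- by apply/eqP=> /setP/(_ x); rewrite inE -{1}[x]expg1 mem_cycle_sqr.
move=> v w /S_T[t /T_odd odd_t].
have [j odd_j ->] := expgz_odd even_n odd_t.
have /cycleP[i ->] : v \in <[x]> by rewrite gen_x inE.
move/(canRL (mulKVg _)) ->.
by rewrite -expgD !mem_cycle_sqr // oddD odd_j addbT.
Qed.
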